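(* Suppose there is a data structure that, for any string $S[1,n]$ over the alphabet $[1,\sigma]$, occupies $s(n,\sigma)$ bits and answers queries $rank_a(S,i)$ in time $t(n,\sigma)$. Then the colored predecessor problem for $n$ integers from the universe $[1,n\sigma]$ can be solved in time $t(n,\sigma)+O(1)$ using a data structure that occupies $s(n,\sigma)+O(n+\sigma)$ bits.
   Context: Model: word RAM with word size $w=\Omega(\lg n)$ bits (and $\lg w = O(\lg n)$), supporting arithmetic (including multiplication), bit shifts and bitwise logical operations in constant time; $\lg$ is the base-2 logarithm. For a string $S[1,n]$ over $[1,\sigma]$ and $a\in[1,\sigma]$, $rank_a(S,i)$ is the number of occurrences of $a$ in $S[1,i]$. The colored predecessor problem: a set of $n$ integers from a universe $[1,u]$ is given, each element colored with one of two colors; a query for $x\in[1,u]$ must return the color of the predecessor of $x$ (the largest element of the set that is $\le x$). *)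

(* Defs.v *)
From Stdlib Require Import PeanoNat.
From mathcomp Require Import all_boot.

Set Implicit Arguments.
Unset Strict Implicit.
Unset Printing Implicit Defensive.

(* lg n is rounded up to an integer: this changes none of the O / Omega
   conditions in which it is used. *)
Definition lg (n : nat) : nat := up_log 2 n.

Definition bigO (f g : nat -> nat) : Prop :=
  exists c n0 : nat, forall n, n0 <= n -> f n <= c * g n.

Definition bigOmega (f g : nat -> nat) : Prop := bigO g f.

(* ---------------------------- The word RAM ------------------------------- *)

Inductive binop : Type :=
  | OpAdd | OpSub | OpMul | OpDiv | OpMod
  | OpShl | OpShr
  | OpAnd | OpOr | OpXor
  | OpLt | OpEq.

(* x op y on m-bit integers, modulo 2 ^ m; a shift distance is not bounded
   by m, and x / 0 = 0, x mod 0 = x. *)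
Definition eval_binop (m : nat) (o : binop) (x0 y0 : nat) : nat :=
  let x := x0 %% 2 ^ m in
  let y := y0 %% 2 ^ m in
  (match o with
   | OpAdd => x + y
   | OpSub => x + (2 ^ m - y)
   | OpMul => x * y
   | OpDiv => x %/ y
   | OpMod => x %% y
   | OpShl => x * 2 ^ y
   | OpShr => x %/ 2 ^ y
   | OpAnd => Nat.land x y
   | OpOr  => Nat.lor x y
   | OpXor => Nat.lxor x y
   | OpLt  => x < y
   | OpEq  => x == y
   end) %% 2 ^ m.

(* A word size of Omega(lg n) bits only guarantees that indices and keys fit
   in a constant number of words.  Hence [Const] and [Bin] carry the number [b]
   of words on which they operate: it is a literal of the program, so this is
   the usual constant-time arithmetic on integers of O(1) words. *)
Inductive instr : Type :=
  | Const (b d v : nat)                (* r_d := v                          *)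
  | Bin (b : nat) (o : binop) (d x y : nat)  (* r_d := r_x o r_y            *)
  | Fetch (d k x : nat)                (* r_d := word r_x of array k        *)
  | Get (d x : nat)                    (* r_d := working_memory[r_x]        *)
  | Put (x y : nat)                    (* working_memory[r_x] := r_y        *)
  | JumpZ (x l : nat).                 (* if r_x = 0 then go to l           *)

Definition program := seq instr.

(* The read-only memory of a static data structure consists of bit arrays,
   which a program addresses by a literal index (so a given program can only
   use a constant number of them).  Space is counted in bits, and an array need
   not fill its last word.  Positions past the end of an array read as 0, so
   that the lengths of the arrays are not accessible to programs. *)
Definition memory := seq bitseq.

Definition bits (D : memory) : nat := \sum_(A <- D) size A.

Definition word_of (w : nat) (A : bitseq) (j : nat) : nat :=
  \sum_(k < w) nth false A (j * w + k) * 2 ^ k.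

Record state : Type := State {
  pc   : nat;
  regs : nat -> nat;
  work : nat -> nat   (* read-write scratch space of one query *)
}.

Definition update (f : nat -> nat) (d v : nat) : nat -> nat :=
  fun k => if k == d then v else f k.

Definition exec (w : nat) (D : memory) (i : instr) (st : state) : state :=
  let: State p r m := st in
  match i with
  | Const b d v   => State p.+1 (update r d (v %% 2 ^ (b * w))) m
  | Bin b o d x y => State p.+1 (update r d (eval_binop (b * w) o (r x) (r y))) m
  | Fetch d k x    => State p.+1 (update r d (word_of w (nth [::] D k) (r x))) m
  | Get d x       => State p.+1 (update r d (m (r x))) m
  | Put x y       => State p.+1 r (update m (r x) (r y %% 2 ^ w))
  | JumpZ x l     => State (if r x == 0 then l else p.+1) r m
  end.

Definition step (w : nat) (P : program) (D : memory) (st : state) : state :=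
  if onth P (pc st) is Some i then exec w D i st else st.

Definition init (input : seq nat) : state :=
  State 0 (fun k => nth 0 input k) (fun=> 0).

(* A program halts when its program counter leaves the code; [step] is then the
   identity, so the following says that it has halted with output [v] (in
   register 0) after at most [T] executed instructions. *)
Definition outputs_within (w : nat) (P : program) (D : memory)
    (input : seq nat) (T v : nat) : Prop :=
  let st := iter T (step w P D) (init input) in
  size P <= pc st /\ regs st 0 = v.

(* -------------------------- The two problems ----------------------------- *)

Definition is_string (n sigma : nat) (S : seq nat) : Prop :=
  size S = n /\ {in S, forall a, 1 <= a <= sigma}.

Definition rank (a : nat) (S : seq nat) (i : nat) : nat :=
  count_mem a (take i S).

Definition is_point_set (n u : nat) (X : seq nat) : Prop :=
  [/\ size X = n, uniq X & {in X, forall x, 1 <= x <= u}].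

Definition has_predecessor (X : seq nat) (x : nat) : bool :=
  has (fun y => y <= x) X.

Definition predecessor (X : seq nat) (x : nat) : nat :=
  \max_(y <- X | y <= x) y.

(* The colors are encoded as 1 and 2; 0 reports that x has no predecessor. *)
Definition predecessor_color (X : seq nat) (color : nat -> bool) (x : nat) : nat :=
  if has_predecessor X x then (color (predecessor X x)).+1 else 0.

(* Symbols, like positions, must fit in a constant number K of words. *)
Definition admissible (w : nat -> nat) (K n sigma : nat) : Prop :=
  [/\ 0 < n, 0 < sigma & lg sigma <= K * w n].

(* The same program serves all n, sigma and all strings; it receives n, sigma,
   the word size and the query arguments in its first registers. *)
Definition rank_solvable (w : nat -> nat) (K : nat)
    (s t : nat -> nat -> nat) : Prop :=
  exists P : program, forall n sigma : nat, admissible w K n sigma ->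
  forall S : seq nat, is_string n sigma S ->
  exists D : memory, bits D <= s n sigma /\
  forall a i : nat, 1 <= a <= sigma -> 1 <= i <= n ->
    outputs_within (w n) P D [:: n; sigma; w n; a; i] (t n sigma) (rank a S i).

Definition colored_predecessor_solvable (w : nat -> nat) (K : nat)
    (s t : nat -> nat -> nat) : Prop :=
  exists P : program, forall n sigma : nat, admissible w K n sigma ->
  forall (X : seq nat) (color : nat -> bool), is_point_set n (n * sigma) X ->
  exists D : memory, bits D <= s n sigma /\
  forall x : nat, 1 <= x <= n * sigma ->
    outputs_within (w n) P D [:: n; sigma; w n; x] (t n sigma)
      (predecessor_color X color x).

(* Main.v *)
Require Import Defs.
From mathcomp Require Import all_boot.
From mathcomp Require Import zify.

Set Implicit Arguments.
Unset Strict Implicit.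
Unset Printing Implicit Defensive.

(* Lay out [1, n * sigma] as a grid of sigma rows and n columns, and let the
   string list the rows of the n points by increasing column. The number of
   points up to x is the number of points in the rows above x plus
   rank_a(S, i), where a is the row of x and i the number of points in the
   columns up to that of x. A table of two bits per point, indexed by this
   number, gives the color.

   Both auxiliary counts are values of a nondecreasing function f on [0, m]
   bounded by n, which is stored in O(n + m) bits as follows. With lam about
   lg (n + m) and mu = Theta(lg lam), [0, m] is cut into blocks of mu * lam
   arguments, and blocks into subblocks of mu arguments. The values of f at the
   block starts are stored with lam bits each, its values at the subblock
   bounds relative to the block start with mu bits each. A block on which f
   grows by at least mu * lam ^ 2 lists its values explicitly, and a subblock
   on which f grows by at least mu ^ 2 does so relative to its block. These
   lists are written at the bit position given by the value of f at the start
   of the block or subblock: they fit in the growth of f, so that n bits suffice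
   and no pointer is needed. In the other subblocks f is read off a window of
   mu ^ 2 + mu bits of the unary code of f, with ones at the positions j + f j,
   by means of a table indexed by the window. *)

(** * Bit arrays *)

Definition bit (v k : nat) : bool := odd (v %/ 2 ^ k).

(** The first bit is the least significant one and bits past the end read as 0, so that
    [num A (j * w) w] is convertible to [word_of w A j]. *)
Definition num (A : bitseq) (p len : nat) : nat :=
  \sum_(k < len) nth false A (p + k) * 2 ^ k.

Lemma num_recr A p len :
  num A p len.+1 = num A p len + nth false A (p + len) * 2 ^ len.
Proof. by rewrite /num big_ord_recr. Qed.

Lemma num_add A p a b : num A p (a + b) = num A p a + 2 ^ a * num A (p + a) b.
Proof.
rewrite /num big_split_ord /= big_distrr; congr addn.
by apply: eq_bigr => k _; rewrite addnA expnD mulnCA.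
Qed.

Lemma num_lt A p len : num A p len < 2 ^ len.
Proof.
elim: len => [|len IH]; first by rewrite /num big_ord0.
by rewrite num_recr expnS; case: nth => /=; lia.
Qed.

Lemma num_div A p a b : num A p (a + b) %/ 2 ^ a = num A (p + a) b.
Proof.
by rewrite num_add addnC mulnC divnMDl ?expn_gt0 // divn_small ?num_lt ?addn0.
Qed.

Lemma num_mod A p a b : num A p (a + b) %% 2 ^ a = num A p a.
Proof. by rewrite num_add addnC mulnC modnMDl modn_small ?num_lt. Qed.

Lemma modn_expS v k : v %% 2 ^ k.+1 = v %% 2 ^ k + bit v k * 2 ^ k.
Proof.
have p0 : 0 < 2 ^ k by rewrite expn_gt0.
rewrite /bit -modn2 expnSr.
set q := v %/ 2 ^ k.
rewrite {1}(divn_eq v (2 ^ k)) -/q {1}(divn_eq q 2) mulnDl -mulnA -addnA mulnC.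
rewrite (mulnC 2) mulnC modnMDl modn_small 1?addnC //.
have := ltn_pmod v p0; have := ltn_pmod q (isT : 0 < 2); nia.
Qed.

Lemma num_eq A p len v :
  (forall k, k < len -> nth false A (p + k) = bit v k) ->
  num A p len = v %% 2 ^ len.
Proof.
elim: len => [|len IH] h; first by rewrite /num big_ord0 modn1.
by rewrite num_recr modn_expS h // IH // => k kl; apply: h; apply: leqW.
Qed.

Lemma bit_num A p len k : k < len -> bit (num A p len) k = nth false A (p + k).
Proof.
move=> kl; rewrite /bit -(subnKC (ltnW kl)) num_div.
rewrite -(subnSK kl) -add1n num_add oddD oddM /= addbF.
by rewrite num_recr /num big_ord0 addn0 muln1 add0n; case: nth.
Qed.

(* Row [i] of the table starts at bit [F i]; entry [k] of this row takes the
   [wd] bits from [F i + k * wd], if they fit before the next row. *)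
Definition pack (M : nat) (F : nat -> nat) (wd : nat) (v : nat -> nat -> nat)
    (N : nat) : bitseq :=
  mkseq (fun p => let i := find (fun i => p < F i.+1) (iota 0 M) in
                  bit (v i ((p - F i) %/ wd)) ((p - F i) %% wd)) N.

Lemma size_pack M F wd v N : size (pack M F wd v N) = N.
Proof. exact: size_mkseq. Qed.

(** Rows may be empty, since [F] is only nondecreasing; the search still stops at row [i], as any
    earlier row ends at [F i] or before. *)
Lemma find_interval M (F : nat -> nat) i p :
  {homo F : i j / i <= j} -> i < M -> F i <= p < F i.+1 ->
  find (fun i => p < F i.+1) (iota 0 M) = i.
Proof.
move=> Fle iM /andP[Fi iF].
rewrite -(subnKC (ltnW iM)) iotaD find_cat add0n.
case: ifP => [/hasP[j]|_].
  rewrite mem_iota add0n => /andP[_ ji] jF.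
  by have := leq_trans jF (leq_trans (Fle _ _ ji) Fi); rewrite ltnn.
by rewrite size_iota -(subnSK iM) /= iF addn0.
Qed.

Lemma num_pack M F wd v N i k :
  {homo F : i j / i <= j} -> i < M ->
  F i + k.+1 * wd <= F i.+1 -> F i + k.+1 * wd <= N ->
  num (pack M F wd v N) (F i + k * wd) wd = v i k %% 2 ^ wd.
Proof.
move=> Fle iM kF kN; apply: num_eq => d dw.
have wd0 : 0 < wd by apply: leq_ltn_trans dw.
have lt : F i + k * wd + d < F i + k.+1 * wd.
  by rewrite mulSn -addnA ltn_add2l [wd + _]addnC ltn_add2l.
rewrite nth_mkseq ?(leq_trans lt) // (find_interval Fle iM).
  rewrite /= -addnA addKn divnMDl // divn_small // addn0.
  by rewrite modnMDl modn_small.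
by rewrite (leq_trans lt kF) -addnA leq_addr.
Qed.

Lemma num_pack_array M wd v N i :
  i < M -> i.+1 * wd <= N ->
  num (pack M (muln^~ wd) wd (fun i _ => v i) N) (i * wd) wd = v i %% 2 ^ wd.
Proof.
move=> iM iN.
rewrite -[X in num _ X _]addn0 -[X in num _ (_ + X) _](mul0n wd).
apply: (num_pack (F := muln^~ wd)) => //; rewrite ?mul1n -?mulSnr //.
by move=> a b ab; rewrite leq_mul2r ab orbT.
Qed.

(** * Prefix sums in linear space *)

(** This lets a query obtain [lam] and [mu] without knowing their widths: each is alone in its
    array, and reading too far only adds zeros. *)
Lemma num_full A len : size A <= len -> num A 0 len = num A 0 (size A).
Proof.
move=> Al; rewrite -(subnKC Al) num_add /num [X in _ + _ * X]big1 ?muln0 ?addn0 //.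
by move=> k _; rewrite nth_default // add0n leq_addr.
Qed.

Definition select (b v k : nat) : nat :=
  nth 0 [seq p <- iota 0 b | bit v p] k.

(** Row [j] is a one followed by [f j.+1 - f j] zeros. The last row starts at [m + f m], hence the
    length. *)
Definition unary (f : nat -> nat) (m n : nat) : bitseq :=
  pack m.+1 (fun j => j + f j) 1 (fun _ k => k == 0) (m + n).+1.

Section Arrays.

Variables (f : nat -> nat) (m n lam mu : nat).
Hypothesis fle : {homo f : i j / i <= j}.
Hypothesis fn : forall j, f j <= n.

Let L := mu * lam.

Lemma nth_unary j t : j <= m -> t <= f j.+1 - f j ->
  j + f j + t <= m + n -> nth false (unary f m n) (j + f j + t) = (t == 0).
Proof.
move=> jm tf tn; have := fle (leqnSn j) => fj.
have F : {homo (fun j => j + f j) : i k / i <= k}.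
  by move=> a c ac; apply: leq_add => //; apply: fle.
have := @bit_num (unary f m n) (j + f j + t) 1 0 isT; rewrite addn0 => <-.
rewrite -{1}(muln1 t) num_pack //; try lia.
by case: (t == 0).
Qed.

(** The window begins at the one of [j]. Induction on [i] shows that exactly [i] ones precede the
    offset [i + (f (j + i) - f j)], where the one of [j + i] sits: each step passes one more one and
    then only zeros. *)
Lemma select_unary b j k : j + k <= m -> k + (f (j + k) - f j) < b ->
  select b (num (unary f m n) (j + f j) b) k = k + (f (j + k) - f j).
Proof.
set v := num _ _ _ => jkm lt_b.
have v_bit i t : i <= k -> t <= f (j + i).+1 - f (j + i) ->
    i + (f (j + i) - f j) + t < b -> j + i + f (j + i) + t <= m + n ->
  bit v (i + (f (j + i) - f j) + t) = (t == 0).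
  move=> ik tf tb tmn; rewrite bit_num // -(@nth_unary (j + i)) //; try lia.
  by congr nth; have := fle (leq_addr i j); lia.
have cnt i : i <= k -> count (bit v) (iota 0 (i + (f (j + i) - f j))) = i.
  elim: i => [|i IH] ik; first by rewrite addn0 subnn.
  pose x := i + (f (j + i) - f j); rewrite -/x in IH.
  have fij := fle (leq_addr i j); have fS := fle (leqnSn (j + i)).
  have fk : f (j + i.+1) <= f (j + k) by apply: fle; lia.
  rewrite addnS in fk *.
  have -> : i.+1 + (f (j + i).+1 - f j) = x + (f (j + i).+1 - f (j + i)).+1.
    by rewrite /x; lia.
  rewrite iotaD count_cat IH ?(ltnW ik) // add0n /=.
  have fnk := fn (j + k).
  rewrite -[x in bit v x]addn0 v_bit //=; try lia.
  rewrite (_ : count _ _ = 0) ?addn0 ?addn1 //.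
  apply/eqP; rewrite -leqn0 leqNgt -has_count; apply/hasPn => y.
  rewrite mem_iota => /andP[xy yx].
  by rewrite -(subnKC (ltnW xy)) v_bit //; rewrite ?/x in xy yx *; lia.
set x := k + _ in lt_b *.
rewrite /select -(subnKC (ltnW lt_b)) iotaD filter_cat nth_cat size_filter cnt //.
rewrite ltnn subnn -(subnSK lt_b) /= add0n.
have fjk := fle (leq_addr k j); have fnk := fn (j + k).
by rewrite -[x in bit v x]addn0 v_bit //; rewrite ?/x in lt_b *; lia.
Qed.

Definition prefix_arrays : memory :=
  let b := mu * mu + mu in
  let M1 := (m %/ L).+2 in
  let M2 := (m %/ mu).+1 in
  let rel r j := f j - f (r %/ lam * L) in
  [:: pack 1 (muln^~ lam) lam (fun _ _ => lam) lam;
      pack 1 (muln^~ mu) mu (fun _ _ => mu) mu;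
      pack M1 (muln^~ lam) lam (fun i _ => f (i * L)) (M1 * lam);
      pack M1 (fun i => f (i * L)) lam (fun i k => f (i * L + k)) n;
      pack M2 (muln^~ mu) mu (fun r _ => rel r (r * mu)) (M2 * mu);
      pack M2 (muln^~ mu) mu (fun r _ => rel r (r.+1 * mu)) (M2 * mu);
      pack M2 (fun r => f (r * mu)) mu (fun r k => rel r (r * mu + k)) n;
      unary f m n;
      pack (2 ^ b) (muln^~ (mu * mu)) mu (fun v k => select b v k - k)
        (2 ^ b * (mu * mu))].

Lemma bits_prefix_arrays : 0 < mu -> 0 < lam -> 2 ^ lam <= 2 * (n + m) ->
  forall e, 2 ^ (mu * mu + mu) * (mu * mu) <= e * 2 ^ lam ->
  bits prefix_arrays <= (8 * e + 30) * (n + m).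
Proof.
move=> mu0 lam0 lamN e be.
have lam2 := ltn_expl lam (isT : 1 < 2).
rewrite /bits /prefix_arrays !big_cons big_nil /unary !size_pack.
have mub : mu <= e * 2 ^ lam.
  apply: leq_trans be; have := expn_gt0 2 (mu * mu + mu); nia.
set T := 2 ^ _ * _ in be *.
have : m %/ L * lam <= m.
  rewrite (leq_trans _ (leq_trunc_div m L)) // leq_mul2l /L leq_pmull ?orbT //.
have := leq_trunc_div m mu.
(* The term [8 * x] pays for three summands [mu] and the window table, each at most [2 * x]. *)
rewrite mulnDl -mulnA; set x := e * (n + m).
have : e * 2 ^ lam <= 2 * x by rewrite /x; nia.
rewrite !mulSn; move: mub be.
set y := e * 2 ^ lam; set p := m %/ mu * mu; set q := m %/ L * lam.
lia.
Qed.

Hypothesis mu0 : 0 < mu.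
Hypothesis lam0 : 0 < lam.
Hypothesis nlam : n < 2 ^ lam.
Hypothesis Lmu : L * lam <= 2 ^ mu.

Let A := nth [::] prefix_arrays.

Lemma prefix_lam len : lam <= len -> num (A 0) 0 len = lam.
Proof.
move=> le; rewrite num_full size_pack //.
have := @num_pack_array 1 lam (fun=> lam) lam 0 isT; rewrite mul0n mul1n => -> //.
by rewrite modn_small // ltn_expl.
Qed.

Lemma prefix_mu len : mu <= len -> num (A 1) 0 len = mu.
Proof.
move=> le; rewrite num_full size_pack //.
have := @num_pack_array 1 mu (fun=> mu) mu 0 isT; rewrite mul0n mul1n => -> //.
by rewrite modn_small // ltn_expl.
Qed.

Lemma prefix_block i : i <= (m %/ L).+1 -> num (A 2) (i * lam) lam = f (i * L).
Proof.
move=> iM; rewrite num_pack_array ?modn_small ?leq_mul2r ?ltnS ?iM ?orbT //.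
exact: leq_ltn_trans (fn _) nlam.
Qed.

Let blocks_le t : {homo (fun i => f (i * t)) : i j / i <= j}.
Proof. by move=> a c ac; apply: fle; rewrite leq_mul2r ac orbT. Qed.

(** The list needs [L * lam] bits, and its row runs from [f (i * L)] to [f (i.+1 * L)]: the growth
    of [f] is exactly the room available. *)
Lemma prefix_sparse i k : i <= m %/ L -> k < L ->
  L * lam <= f (i.+1 * L) - f (i * L) ->
  num (A 3) (f (i * L) + k * lam) lam = f (i * L + k).
Proof.
move=> iM kL sp.
have k1 : k.+1 * lam <= L * lam by rewrite leq_mul2r kL orbT.
have fi : f (i * L) <= f (i.+1 * L) by apply: fle; rewrite leq_mul2r leqnSn orbT.
rewrite (num_pack (F := fun i => f (i * L))) ?modn_small //.
- exact: leq_ltn_trans (fn _) nlam.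
- by apply: leq_trans iM _.
- by move: sp; lia.
- by apply: leq_trans (fn (i.+1 * L)); move: sp; lia.
Qed.

Section Dense.

Variable r : nat.
Hypothesis rm : r <= m %/ mu.
Let i := r %/ lam.
Hypothesis dense : f (i.+1 * L) - f (i * L) < L * lam.

(** [L] is a multiple of [mu], so no subblock crosses a block boundary. *)
Let rmL k : k <= mu -> i * L <= r * mu + k <= i.+1 * L.
Proof.
move=> kmu; rewrite /L.
have := ltn_pmod r lam0; have := divn_eq r lam; rewrite -/i => -> q.
by apply/andP; split; nia.
Qed.

(** The growth on a dense block is below [L * lam <= 2 ^ mu], so relative values fit in [mu]
    bits. *)
Let rel_lt k : k <= mu -> f (r * mu + k) - f (i * L) < 2 ^ mu.
Proof.
move=> kmu; have /andP[_ le] := rmL kmu.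
by have := fle le; move: dense Lmu; lia.
Qed.

Lemma prefix_subblock : num (A 4) (r * mu) mu = f (r * mu) - f (i * L).
Proof.
rewrite num_pack_array ?modn_small ?leq_mul2r ?ltnS ?rm ?orbT //.
by rewrite -[r * mu]addn0 rel_lt.
Qed.

Lemma prefix_subblock_end :
  num (A 5) (r * mu) mu = f (r.+1 * mu) - f (i * L).
Proof.
rewrite num_pack_array ?modn_small ?leq_mul2r ?ltnS ?rm ?orbT //.
by rewrite mulSnr rel_lt.
Qed.

Lemma prefix_subsparse k : k < mu -> mu * mu <= f (r.+1 * mu) - f (r * mu) ->
  num (A 6) (f (r * mu) + k * mu) mu = f (r * mu + k) - f (i * L).
Proof.
move=> kmu sp.
have k1 : k.+1 * mu <= mu * mu by rewrite leq_mul2r kmu orbT.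
have fr : f (r * mu) <= f (r.+1 * mu) by apply: fle; rewrite leq_mul2r leqnSn orbT.
rewrite (num_pack (F := fun r => f (r * mu))) ?modn_small //.
- exact/rel_lt/ltnW.
- by move: sp; lia.
- by apply: leq_trans (fn (r.+1 * mu)); move: sp; lia.
Qed.

(** The one of [r * mu + k] is preceded in its window by [k < mu] ones and fewer than [mu * mu]
    zeros, so the window of [mu * mu + mu] bits contains it. *)
Lemma prefix_subdense k : k < mu -> r * mu + k <= m ->
  f (r.+1 * mu) - f (r * mu) < mu * mu ->
  let v := num (A 7) (r * mu + f (r * mu)) (mu * mu + mu) in
  num (A 8) ((v * mu + k) * mu) mu = f (r * mu + k) - f (r * mu).
Proof.
move=> kmu km sp v.
have k1 : k.+1 * mu <= mu * mu by rewrite leq_mul2r kmu orbT.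
have fk : f (r * mu + k) <= f (r.+1 * mu).
  by apply: fle; rewrite mulSnr leq_add2l ltnW.
have vb : v < 2 ^ (mu * mu + mu) by apply: num_lt.
rewrite mulnDl -mulnA (num_pack (F := muln^~ (mu * mu))) ?mulSnr ?leq_add2l //.
- rewrite /v /= select_unary //; last by lia.
  rewrite addKn modn_small //.
  have /andP[fi _] := rmL (leq0n mu); rewrite addn0 in fi.
  by have := rel_lt (ltnW kmu); have := fle fi; lia.
- by move=> a c ac; rewrite leq_mul2r ac orbT.
- by rewrite -mulSnr.
- have : v.+1 * (mu * mu) <= 2 ^ (mu * mu + mu) * (mu * mu).
    by rewrite leq_mul2r vb orbT.
  by apply: leq_trans; rewrite mulSnr leq_add2l -mulSnr.
Qed.

End Dense.
End Arrays.

(** * Choice of the subblock size *)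

Definition subblock_size (lam : nat) : nat := 3 * up_log 2 lam + 4.

(** With [k = up_log 2 lam], the exponent [3 * k] provides [lam ^ 2] and one more factor [2 ^ k],
    which together with [2 ^ 4] dominates [3 * k + 4]. *)
Lemma block_size_le lam : 0 < lam ->
  subblock_size lam * lam * lam <= 2 ^ subblock_size lam.
Proof.
rewrite /subblock_size; have := up_logP lam (isT : 1 < 2).
set k := up_log 2 lam; move=> le lam0.
have kk := ltn_expl k (isT : 1 < 2).
rewrite expnD [3 * k]mulnC expnM -mulnA [k * 3]mulnC.
have := leq_mul le le; set x := 2 ^ k in kk * => ll.
have k4 : 3 * k + 4 <= 16 * x by lia.
by rewrite (leq_trans (leq_mul k4 ll)) // !expnS expn0; lia.
Qed.

(* The constant stays abstract, since 2 ^ c0 cannot be computed in unary. *)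
Lemma window_size_le : exists c0, forall lam, 0 < lam ->
  let mu := subblock_size lam in mu * mu + 3 * mu <= lam + c0.
Proof.
exists 1000 => lam lam0; rewrite /subblock_size.
case: (leqP lam 1) => [l1|l1].
  by have -> : lam = 1 by lia.
have := up_log_gtn (isT : 1 < 2) l1.
set k := up_log 2 lam => lt.
suff : (3 * k + 4) * (3 * k + 4) + 3 * (3 * k + 4) <= 2 ^ k.-1 + 1000 by lia.
move: k {lt}.
(* The second conjunct bounds the exact increment of the left side of the first: for
   [y = 3 * (k + 12) + 4], replacing [y] by [y + 3] adds [6 * y + 18]. *)
have big k : (3 * (k + 12) + 4) * (3 * (k + 12) + 4) + 3 * (3 * (k + 12) + 4)
    <= 2 ^ (k + 11) /\ 18 * (k + 12) + 42 <= 2 ^ (k + 11).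
  elim: k => [|k [IH1 IH2]]; first by rewrite !add0n; split; lia.
  rewrite (addSn k 12) (addSn k 11) expnS.
  rewrite (_ : 3 * (k + 12).+1 + 4 = 3 * (k + 12) + 4 + 3); last by lia.
  move: IH1 IH2; set y := 3 * (k + 12) + 4 => IH1 IH2.
  have yk : 18 * (k + 12) + 42 = 6 * y + 18 by rewrite /y; lia.
  split; first by rewrite !(mulnDl, mulnDr); lia.
  by lia.
move=> k; case: (leqP 12 k) => [k12|].
  have [h _] := big (k - 12); rewrite subnK // in h.
  have -> : k.-1 = k - 12 + 11 by lia.
  lia.
by do 12! [case: k => [//|k]].
Qed.

(** * Expressions and their evaluation *)

(** Expressions are branch-free, so that their evaluation time depends on their size alone, which is
    constant once the literals are fixed. *)
Inductive expr : Type :=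
  | Var (v : nat)
  | Cst (v : nat)
  | Op (o : binop) (e1 e2 : expr)
  | Word (k : nat) (e : expr).

Fixpoint bounded (v : nat) (e : expr) : bool :=
  match e with
  | Var u => u < v
  | Cst _ => true
  | Op _ e1 e2 => bounded v e1 && bounded v e2
  | Word _ e1 => bounded v e1
  end.

Definition If (c a b : expr) : expr :=
  Op OpAdd (Op OpMul c a) (Op OpMul (Op OpSub (Cst 1) c) b).

(** Horner's scheme in base [2 ^ w]. The number [T] of words is a literal, whereas the word size is
    only known at run time, as the value of [W]. *)
Fixpoint words (W : expr) (T k : nat) (j : expr) : expr :=
  if T is T'.+1 then
    Op OpAdd (Word k j)
      (Op OpMul (words W T' k (Op OpAdd j (Cst 1))) (Op OpShl (Cst 1) W))
  else Cst 0.

(** A field of at most [R * w] bits that is not aligned to words can touch [R.+1] of them. *)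
Definition read (W : expr) (R k : nat) (p len : expr) : expr :=
  Op OpMod (Op OpShr (words W R.+1 k (Op OpDiv p W)) (Op OpMod p W))
    (Op OpShl (Cst 1) len).

Section Eval.

Variables (B w : nat) (D : memory) (r : nat -> nat).

(** A variable is reduced modulo [2 ^ (B * w)] because [code] copies it by an [OpOr] on [B]
    words. *)
Fixpoint eval (e : expr) : nat :=
  match e with
  | Var v => r v %% 2 ^ (B * w)
  | Cst v => v %% 2 ^ (B * w)
  | Op o e1 e2 => eval_binop (B * w) o (eval e1) (eval e2)
  | Word k e1 => word_of w (nth [::] D k) (eval e1)
  end.

Hypotheses (B0 : 0 < B) (w0 : 0 < w).

Let Q := B * w.
Let Q0 : 0 < Q. Proof. by rewrite muln_gt0 B0. Qed.

Lemma eval_lt e : eval e < 2 ^ Q.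
Proof.
case: e => [v|v|o e1 e2|k e1] /=; rewrite ?ltn_pmod ?expn_gt0 //.
by apply: leq_trans (num_lt _ _ _) _; rewrite leq_exp2l // leq_pmull.
Qed.

Let eval_small e : eval e %% 2 ^ Q = eval e.
Proof. by rewrite modn_small // eval_lt. Qed.

Lemma eval_cst v : v < 2 ^ Q -> eval (Cst v) = v.
Proof. exact: modn_small. Qed.

Lemma eval_var v : r v < 2 ^ Q -> eval (Var v) = r v.
Proof. exact: modn_small. Qed.

Lemma eval_add a b : eval a + eval b < 2 ^ Q ->
  eval (Op OpAdd a b) = eval a + eval b.
Proof. by move=> h; rewrite /= /eval_binop !eval_small modn_small. Qed.

Lemma eval_sub a b : eval b <= eval a -> eval (Op OpSub a b) = eval a - eval b.
Proof.
move=> h; rewrite /= /eval_binop !eval_small.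
have := eval_lt a; have := eval_lt b => lb la.
have -> : eval a + (2 ^ Q - eval b) = eval a - eval b + 2 ^ Q by lia.
by rewrite modnDr modn_small //; lia.
Qed.

Lemma eval_mul a b : eval a * eval b < 2 ^ Q ->
  eval (Op OpMul a b) = eval a * eval b.
Proof. by move=> h; rewrite /= /eval_binop !eval_small modn_small. Qed.

Lemma eval_div a b : eval (Op OpDiv a b) = eval a %/ eval b.
Proof.
rewrite /= /eval_binop !eval_small modn_small //.
exact: leq_ltn_trans (leq_div _ _) (eval_lt a).
Qed.

Lemma eval_mod a b : eval (Op OpMod a b) = eval a %% eval b.
Proof.
rewrite /= /eval_binop !eval_small modn_small //.
exact: leq_ltn_trans (leq_mod _ _) (eval_lt a).
Qed.

Lemma eval_shl a b : eval a * 2 ^ eval b < 2 ^ Q ->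
  eval (Op OpShl a b) = eval a * 2 ^ eval b.
Proof. by move=> h; rewrite /= /eval_binop !eval_small modn_small. Qed.

Lemma eval_shr a b : eval (Op OpShr a b) = eval a %/ 2 ^ eval b.
Proof.
rewrite /= /eval_binop !eval_small modn_small //.
exact: leq_ltn_trans (leq_div _ _) (eval_lt a).
Qed.

Let bool_lt (b : bool) : b < 2 ^ Q.
Proof. by apply: leq_trans (_ : 2 ^ 1 <= _); [case: b | rewrite leq_exp2l]. Qed.

Lemma eval_ltn a b : eval (Op OpLt a b) = (eval a < eval b).
Proof. by rewrite /= /eval_binop !eval_small modn_small ?bool_lt. Qed.

Lemma eval_eq a b : eval (Op OpEq a b) = (eval a == eval b).
Proof. by rewrite /= /eval_binop !eval_small modn_small ?bool_lt. Qed.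

(** By [eval_lt] both branches are below [2 ^ Q], even a junk one, and multiplication by 0 or 1
    cannot overflow. *)
Lemma eval_if c a b (x : bool) : eval c = x ->
  eval (If c a b) = if x then eval a else eval b.
Proof.
move=> cx; have c1 : eval (Cst 1) = 1 by apply: eval_cst (bool_lt true).
have s : eval (Op OpSub (Cst 1) c) = ~~ x by rewrite eval_sub cx c1; case: (x).
have la := eval_lt a; have lb := eval_lt b.
have ca : eval (Op OpMul c a) = x * eval a.
  by rewrite eval_mul cx; case: (x); rewrite ?mul1n ?mul0n ?expn_gt0.
have cb : eval (Op OpMul (Op OpSub (Cst 1) c) b) = ~~ x * eval b.
  by rewrite eval_mul s; case: (x); rewrite ?mul1n ?mul0n ?expn_gt0.
rewrite /If eval_add ca cb; first by case: (x); rewrite /= ?mul1n ?mul0n ?addn0.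
by case: (x); rewrite /= ?mul1n ?mul0n ?addn0.
Qed.

Variable W : expr.
Hypothesis eval_W : eval W = w.

Lemma eval_words T k j : eval j + T < 2 ^ Q -> T * w < Q ->
  eval (words W T k j) = num (nth [::] D k) (eval j * w) (T * w).
Proof.
elim: T j => [|T IH] j jT TQ.
  by rewrite /= mod0n mul0n /num big_ord0.
have c1 : eval (Cst 1) = 1 by apply: eval_cst (bool_lt true).
have j1 : eval (Op OpAdd j (Cst 1)) = (eval j).+1.
  by rewrite eval_add c1 ?addn1 //; lia.
have wQ : w <= Q by rewrite mulSn in TQ; lia.
have nT : num (nth [::] D k) (eval j * w) (T.+1 * w) < 2 ^ Q.
  by apply: leq_trans (num_lt _ _ _) _; rewrite leq_exp2l // ltnW.
have w2 : 2 ^ w < 2 ^ Q by rewrite ltn_exp2l // (leq_ltn_trans _ TQ) // leq_pmull.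
rewrite mulSn num_add -mulSnr in nT *.
rewrite [words _ T.+1 _ _]/=.
have sh : eval (Op OpShl (Cst 1) W) = 2 ^ w.
  by rewrite eval_shl c1 eval_W mul1n.
have ih : eval (words W T k (Op OpAdd j (Cst 1))) =
    num (nth [::] D k) ((eval j).+1 * w) (T * w).
  have := IH (Op OpAdd j (Cst 1)); rewrite j1 => -> //; first by rewrite addSnnS.
  by rewrite mulSn in TQ; lia.
have mu : eval (Op OpMul (words W T k (Op OpAdd j (Cst 1)))
    (Op OpShl (Cst 1) W)) =
    2 ^ w * num (nth [::] D k) ((eval j).+1 * w) (T * w).
  by rewrite eval_mul ih sh mulnC //; lia.
by rewrite eval_add mu.
Qed.

Lemma eval_read R k p len : eval len <= R * w -> R.+1 * w < Q ->
  eval p + R.+1 < 2 ^ Q ->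
  eval (read W R k p len) = num (nth [::] D k) (eval p) (eval len).
Proof.
move=> lR RQ pR; rewrite /read eval_mod eval_shr eval_mod eval_W.
have c1 : eval (Cst 1) = 1 by apply: eval_cst (bool_lt true).
rewrite eval_words ?eval_div ?eval_W //; last by have := leq_div (eval p) w; lia.
rewrite eval_shl c1 mul1n; last by rewrite ltn_exp2l //; rewrite mulSn in RQ; lia.
have := ltn_pmod (eval p) w0; set q := eval p %% w => qw.
have -> : R.+1 * w = q + (eval len + (R.+1 * w - q - eval len)).
  by rewrite mulSn; lia.
by rewrite num_div num_mod -divn_eq.
Qed.

End Eval.

Notation "a +^ b" := (Op OpAdd a b) (at level 50, left associativity).
Notation "a -^ b" := (Op OpSub a b) (at level 50, left associativity).
Notation "a *^ b" := (Op OpMul a b) (at level 40, left associativity).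
Notation "a /^ b" := (Op OpDiv a b) (at level 40, left associativity).
Notation "a %^ b" := (Op OpMod a b) (at level 40, left associativity).
Notation "a <^ b" := (Op OpLt a b) (at level 70).

(* Reads f at [j] off the arrays [prefix_arrays f _ _ _ _] stored from index [o]
   on. All cases are evaluated, and [If] discards the junk. *)
Definition prefix_expr (W : expr) (R o : nat) (j : expr) : expr :=
  let lam := words W R o (Cst 0) in
  let mu := words W R (o + 1) (Cst 0) in
  let r := j /^ mu in
  let i := r /^ lam in
  let k := j %^ (mu *^ lam) in
  let l := j %^ mu in
  let block i := read W R (o + 2) (i *^ lam) lam in
  let base := block i in
  let sub := read W R (o + 4) (r *^ mu) mu in
  let window :=
    read W R (o + 7) (r *^ mu +^ (base +^ sub)) (mu *^ mu +^ mu) in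
  If (block (i +^ Cst 1) -^ base <^ mu *^ lam *^ lam)
    (base +^ If (read W R (o + 5) (r *^ mu) mu -^ sub <^ mu *^ mu)
       (sub +^ read W R (o + 8) ((window *^ mu +^ l) *^ mu) mu)
       (read W R (o + 6) (base +^ sub +^ l *^ mu) mu))
    (read W R (o + 3) (base +^ k *^ lam) lam).

Section EvalPrefix.

Variables (R w : nat) (D : memory) (reg : nat -> nat) (W : expr).
Let B := 4 * R + 4.
Hypotheses (R0 : 0 < R) (w0 : 0 < w) (eval_W : eval B w D reg W = w).

Variables (f : nat -> nat) (m n lam mu o : nat).
Hypothesis fle : {homo f : i j / i <= j}.
Hypothesis fn : forall j, f j <= n.
Hypotheses (mu0 : 0 < mu) (lam0 : 0 < lam).
Hypothesis nlam : n < 2 ^ lam.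
Hypothesis mlam : m.+1 < 2 ^ lam.
Hypothesis Lmu : mu * lam * lam <= 2 ^ mu.
Hypothesis stored : forall i, i < 9 ->
  nth [::] D (o + i) = nth [::] (prefix_arrays f m n lam mu) i.
Hypothesis lamR : lam <= R * w.
Hypothesis muR : mu * mu + mu <= R * w.
Hypothesis muR2 : 2 ^ (mu * mu + mu) * (mu * mu) <= 2 ^ (R * w).

Variables (e : expr) (j : nat).
Hypotheses (eval_e : eval B w D reg e = j) (jm : j <= m).

(** All stored values are below [Z = 2 ^ (R * w)], and the positions and products computed on the
    relevant branch are below [Z ^ 3]. As [Z ^ 4 <= 2 ^ (B * w)], none of them overflows, and each
    read reduces to the lemma on its array. *)
Lemma eval_prefix : eval B w D reg (prefix_expr W R o e) = f j.
Proof.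
have B0 : 0 < B by rewrite /B addnS.
have muZ := muR2; set Z := 2 ^ (R * w) in muZ.
have Rw : R <= R * w by rewrite leq_pmulr.
have Z2 : 2 <= Z by rewrite -{1}(expn1 2) leq_exp2l //; lia.
have RZ : R < Z by apply: leq_ltn_trans Rw (ltn_expl _ _).
have ZQ : Z * Z * Z * Z <= 2 ^ (B * w).
  by rewrite /Z -!expnD leq_exp2l // /B; nia.
have Z22 : Z * 2 <= Z * Z by rewrite leq_mul2l Z2 orbT.
have Z32 : Z * Z * 2 <= Z * Z * Z by rewrite leq_mul2l Z2 orbT.
have Z42 : Z * Z * Z * 2 <= Z * Z * Z * Z by rewrite leq_mul2l Z2 orbT.
have ZQ3 x : x < Z * Z * Z -> x + R.+1 < 2 ^ (B * w) by lia.
have Z1 x : x < Z -> x < Z * Z * Z by lia.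
have Zadd x y : x < Z -> y < Z -> x + y < Z * Z * Z by lia.
have Zmul x y : x < Z -> y < Z -> x * y < Z * Z * Z.
  by move=> /ltnW xZ yZ; have := leq_mul xZ (ltnW yZ); lia.
have Zmuladd x y z : x < Z -> y < Z -> z < Z -> z + x * y < Z * Z * Z.
  by move=> /ltnW xZ yZ zZ; have := leq_mul xZ (ltnW yZ); lia.
have lt3 x : x < Z * Z * Z -> x < 2 ^ (B * w) by move/ZQ3; lia.
have RQ : R.+1 * w < B * w by rewrite ltn_mul2r w0 /B; lia.
have RQ' : R * w < B * w by rewrite ltn_mul2r w0 /B; lia.
have lamZ : 2 ^ lam <= Z by rewrite leq_exp2l.
have nZ := leq_trans nlam lamZ; have mZ := leq_trans mlam lamZ.
have llZ : lam < Z by apply: leq_trans (ltn_expl lam _) lamZ.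
have muZ1 : mu * mu + mu < Z.
  by apply: leq_trans (ltn_expl _ (isT : 1 < 2)) _; rewrite leq_exp2l.
have Z0 : 0 < Z by lia.
have c0 : eval B w D reg (Cst 0) = 0 by rewrite eval_cst ?expn_gt0.
have c1 : eval B w D reg (Cst 1) = 1 by rewrite eval_cst //; apply: lt3; apply: Z1.
rewrite /prefix_expr.
set elam := words W R o _; set emu := words W R (o + 1) _.
have Elam : eval B w D reg elam = lam.
  rewrite eval_words ?c0 ?mul0n //; last by rewrite add0n; apply: lt3; apply: Z1.
  by rewrite -(addn0 o) stored // prefix_lam.
have Emu : eval B w D reg emu = mu.
  rewrite eval_words ?c0 ?mul0n //; last by rewrite add0n; apply: lt3; apply: Z1.
  by rewrite stored // prefix_mu //; apply: leq_trans muR; apply: leq_addl.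
have rd k p q : eval B w D reg q <= R * w -> eval B w D reg p < Z * Z * Z ->
    k < 9 ->
    eval B w D reg (read W R (o + k) p q) =
    num (nth [::] (prefix_arrays f m n lam mu) k) (eval B w D reg p)
      (eval B w D reg q).
  by move=> qR pZ k9; rewrite eval_read // ?stored //; apply: ZQ3.
have add a b x y : eval B w D reg a = x -> eval B w D reg b = y ->
    x + y < Z * Z * Z -> eval B w D reg (a +^ b) = x + y.
  by move=> <- <- ?; rewrite eval_add //; apply: lt3.
have mul a b x y : eval B w D reg a = x -> eval B w D reg b = y ->
    x * y < Z * Z * Z -> eval B w D reg (a *^ b) = x * y.
  by move=> <- <- ?; rewrite eval_mul //; apply: lt3.
set er := e /^ emu; set ei := er /^ elam; set r := j %/ mu.
have Er : eval B w D reg er = r by rewrite eval_div // eval_e Emu.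
have Ei : eval B w D reg ei = r %/ lam by rewrite eval_div // Er Elam.
set i := r %/ lam in Ei.
have iL : i = j %/ (mu * lam) by rewrite divnMA.
have L0 : 0 < mu * lam by rewrite muln_gt0 mu0.
have im : i <= m %/ (mu * lam) by rewrite iL leq_div2r.
have rm : r <= m %/ mu by rewrite leq_div2r.
have ij : i * (mu * lam) <= j by rewrite iL leq_trunc_div.
have rj : r * mu <= j by rewrite leq_trunc_div.
have iZ : i.+1 < Z.
  apply: leq_ltn_trans mZ; rewrite ltnS (leq_trans (leq_div _ _)) //.
  exact: leq_trans (leq_div _ _) jm.
have muZ' : mu < Z by apply: leq_ltn_trans muZ1; apply: leq_addl.
have mmZ : mu * mu < Z by apply: leq_ltn_trans muZ1; apply: leq_addr.
have i0Z : i < Z by apply: ltnW.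
have jZ : j < Z by apply: leq_ltn_trans jm (ltnW mZ).
have fZ x : f x < Z by apply: leq_ltn_trans (fn x) nZ.
have Ebi : eval B w D reg (ei *^ elam) = i * lam by apply: mul; rewrite ?Zmul.
have Ei1 : eval B w D reg (ei +^ Cst 1) = i + 1 by apply: add; rewrite ?Zadd.
have Ebi1 : eval B w D reg ((ei +^ Cst 1) *^ elam) = (i + 1) * lam.
  by apply: mul; rewrite ?Zmul // addn1.
set base := read _ _ (o + 2) (ei *^ elam) _.
have Ebase : eval B w D reg base = f (i * (mu * lam)).
  by rewrite rd ?Ebi ?Elam ?prefix_block ?Zmul // ltnW.
have Enext : eval B w D reg (read W R (o + 2) ((ei +^ Cst 1) *^ elam) elam) =
    f (i.+1 * (mu * lam)).
  by rewrite rd ?Ebi1 ?Elam ?addn1 ?prefix_block ?Zmul.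
have fi : f (i * (mu * lam)) <= f (i.+1 * (mu * lam)).
  by apply: fle; rewrite leq_mul2r leqnSn orbT.
have EL : eval B w D reg (emu *^ elam) = mu * lam by apply: mul; rewrite ?Zmul.
have L2Z : mu * lam * lam < Z.
  apply: leq_ltn_trans Lmu _; apply: leq_trans muZ.
  apply: leq_trans (leq_pmulr _ _); last by rewrite muln_gt0 mu0.
  by rewrite ltn_exp2l // -[ltnLHS]add0n ltn_add2r muln_gt0 mu0.
have EL2 : eval B w D reg (emu *^ elam *^ elam) = mu * lam * lam.
  by apply: mul; rewrite ?Z1.
rewrite (@eval_if _ _ _ _ B0 w0 _ _ _
  (f (i.+1 * (mu * lam)) - f (i * (mu * lam)) < mu * lam * lam)) //;
  last by rewrite eval_ltn // eval_sub ?Enext ?Ebase ?EL2.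
case: ltnP => [dense|sparse]; last first.
  have Ek : eval B w D reg (e %^ (emu *^ elam)) = j %% (mu * lam).
    by rewrite eval_mod // eval_e EL.
  have kL : j %% (mu * lam) < mu * lam by rewrite ltn_pmod.
  have kZ : j %% (mu * lam) < Z by apply: leq_ltn_trans (leq_mod _ _) jZ.
  have Ekl : eval B w D reg (e %^ (emu *^ elam) *^ elam) =
      j %% (mu * lam) * lam by apply: mul; rewrite ?Zmul.
  have Ep : eval B w D reg (base +^ e %^ (emu *^ elam) *^ elam) =
      f (i * (mu * lam)) + j %% (mu * lam) * lam by apply: add; rewrite ?Zmuladd.
  rewrite rd ?Ep ?Elam ?Zmuladd // prefix_sparse //.
  by rewrite {2}(divn_eq j (mu * lam)) -iL.
have Erm : eval B w D reg (er *^ emu) = r * mu.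
  by apply: mul => //; apply: Z1; apply: leq_ltn_trans rj jZ.
have rmZ : r * mu < Z by apply: leq_ltn_trans rj jZ.
set sub := read _ _ (o + 4) _ _.
have muRw : mu <= R * w by apply: leq_trans muR; apply: leq_addl.
have Esub : eval B w D reg sub = f (r * mu) - f (i * (mu * lam)).
  by rewrite rd ?Erm ?Emu ?(prefix_subblock (m := m)) ?Z1.
have ir : i * (mu * lam) <= r * mu.
  by rewrite [mu * lam]mulnC mulnA leq_mul2r leq_trunc_div orbT.
have ri : r.+1 * mu <= i.+1 * (mu * lam).
  by rewrite [mu * lam]mulnC mulnA leq_mul2r ltn_ceil // orbT.
have fr := fle ir.
have fr1 : f (r * mu) <= f (r.+1 * mu).
  by apply: fle; rewrite leq_mul2r leqnSn orbT.
have Eend : eval B w D reg (read W R (o + 5) (er *^ emu) emu) =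
    f (r.+1 * mu) - f (i * (mu * lam)).
  by rewrite rd ?Erm ?Emu ?prefix_subblock_end ?Z1.
have Emm : eval B w D reg (emu *^ emu) = mu * mu by apply: mul; rewrite ?Z1.
have El : eval B w D reg (e %^ emu) = j %% mu by rewrite eval_mod // eval_e Emu.
have lmu : j %% mu < mu by rewrite ltn_pmod.
have lZ : j %% mu < Z by apply: ltn_trans lmu muZ'.
have jE : j = r * mu + j %% mu by rewrite -divn_eq.
have frj := fle rj.
have Ebs : eval B w D reg (base +^ sub) = f (r * mu).
  by rewrite (add _ _ _ _ Ebase Esub) subnKC ?Z1.
have subZ x y : x < Z -> x - y < Z by move=> xZ; apply: leq_ltn_trans (leq_subr _ _) xZ.
(* In a dense block it remains to find [f j] relative to the block start. *)
have Edense inner : eval B w D reg inner = f j - f (i * (mu * lam)) ->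
    eval B w D reg (base +^ inner) = f j.
  move=> Einner; have fbj := leq_trans fr frj.
  by rewrite (add _ _ _ _ Ebase Einner) subnKC ?Z1.
apply: Edense.
rewrite (@eval_if _ _ _ _ B0 w0 _ _ _
  (f (r.+1 * mu) - f (r * mu) < mu * mu)) //; last first.
  rewrite eval_ltn // eval_sub ?Eend ?Esub ?Emm //; last exact: leq_sub2r.
  by rewrite subnBA // subnK // (leq_trans fr).
case: ltnP => [subdense|subsparse]; last first.
  have Elm : eval B w D reg (e %^ emu *^ emu) = j %% mu * mu.
    by apply: mul; rewrite ?Zmul.
  have Ep : eval B w D reg (base +^ sub +^ e %^ emu *^ emu) =
      f (r * mu) + j %% mu * mu by apply: add; rewrite ?Zmuladd.
  by rewrite rd ?Ep ?Emu ?Zmuladd // prefix_subsparse // -jE.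
have Emb : eval B w D reg (emu *^ emu +^ emu) = mu * mu + mu.
  by apply: add; rewrite ?Zadd.
have Ewp : eval B w D reg (er *^ emu +^ (base +^ sub)) = r * mu + f (r * mu).
  by apply: add; rewrite ?Zadd.
set win := read _ _ (o + 7) _ _.
set v := num (nth [::] (prefix_arrays f m n lam mu) 7) (r * mu + f (r * mu))
  (mu * mu + mu).
have Ewin : eval B w D reg win = v by rewrite rd ?Ewp ?Emb ?Zadd.
have vb : v < 2 ^ (mu * mu + mu) by apply: num_lt.
have vT : v.+1 * (mu * mu) <= Z.
  by apply: leq_trans muZ; rewrite leq_mul2r vb orbT.
have vl : v * mu + j %% mu < v.+1 * mu by rewrite mulSnr ltn_add2l.
have vlZ : (v * mu + j %% mu) * mu < Z.
  by apply: leq_trans vT; rewrite mulnA ltn_mul2r mu0.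
have vlZ' : v * mu + j %% mu < Z.
  by apply: leq_ltn_trans vlZ; rewrite leq_pmulr.
have Evm : eval B w D reg (win *^ emu) = v * mu.
  by apply: mul => //; apply: Z1; apply: leq_ltn_trans vlZ'; apply: leq_addr.
have Evl : eval B w D reg (win *^ emu +^ e %^ emu) = v * mu + j %% mu.
  by apply: add; rewrite ?Z1.
have Ep : eval B w D reg ((win *^ emu +^ e %^ emu) *^ emu) =
    (v * mu + j %% mu) * mu by apply: mul; rewrite ?Z1.
have ET : eval B w D reg (read W R (o + 8) ((win *^ emu +^ e %^ emu) *^ emu) emu)
    = f j - f (r * mu).
  by rewrite rd ?Ep ?Emu ?Z1 // prefix_subdense // -?jE.
have -> : f j - f (i * (mu * lam)) =
    f (r * mu) - f (i * (mu * lam)) + (f j - f (r * mu)).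
  by rewrite addnC addnBA // subnK.
by apply: add; rewrite ?Zadd ?subZ.
Qed.

End EvalPrefix.

(** * Straight-line code and relocation of programs *)

Lemma eval_ext B w D r r' v e : bounded v e ->
  (forall u, u < v -> r u = r' u) -> eval B w D r e = eval B w D r' e.
Proof.
move=> be rr'; elim: e be => [u|u|o e1 IH1 e2 IH2|k e IH] //=.
- by move/rr' => ->.
- by case/andP => /IH1 -> /IH2 ->.
- by move/IH => ->.
Qed.

(* The value of [e] goes to register [d]; variable [v] is held in register
   [rho v], and the registers above [d] are used as a stack. *)
Fixpoint code (B : nat) (rho : nat -> nat) (e : expr) (d : nat) : program :=
  match e with
  | Var v => [:: Bin B OpOr d (rho v) (rho v)]
  | Cst v => [:: Const B d v]
  | Op o e1 e2 =>
      code B rho e1 d ++ code B rho e2 d.+1 ++ [:: Bin B o d d d.+1]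
  | Word k e1 => code B rho e1 d ++ [:: Fetch d k d]
  end.

Fixpoint expr_size (e : expr) : nat :=
  match e with
  | Var _ | Cst _ => 1
  | Op _ e1 e2 => expr_size e1 + (expr_size e2 + 1)
  | Word _ e1 => expr_size e1 + 1
  end.

Lemma size_code B rho e d : size (code B rho e d) = expr_size e.
Proof.
by elim: e d => //= [o e1 IH1 e2 IH2|k e IH] d; rewrite !size_cat ?IH1 ?IH2 ?IH.
Qed.

Definition straight (i : instr) : bool :=
  match i with Const _ _ _ | Bin _ _ _ _ _ | Fetch _ _ _ => true | _ => false end.

Lemma straight_code B rho e d : all straight (code B rho e d).
Proof.
by elim: e d => //= [o e1 IH1 e2 IH2|k e IH] d; rewrite !all_cat ?IH1 ?IH2 ?IH.
Qed.

Definition run (w : nat) (D : memory) (c : program) (st : state) : state :=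
  foldl (fun st i => exec w D i st) st c.

Lemma run_cat w D c1 c2 st : run w D (c1 ++ c2) st = run w D c2 (run w D c1 st).
Proof. exact: foldl_cat. Qed.

Lemma straight_run w D c st : all straight c ->
  pc (run w D c st) = pc st + size c /\ work (run w D c st) = work st.
Proof.
elim: c st => [|i c IH] st /=; first by rewrite addn0.
case/andP => si sc; have [-> ->] := IH (exec w D i st) sc.
by case: st => p r m; case: i si => //= *; rewrite addSnnS.
Qed.

Lemma iter_step_run w D pre c post st : all straight c -> pc st = size pre ->
  iter (size c) (step w (pre ++ c ++ post) D) st = run w D c st.
Proof.
elim: c pre st => [|i c IH] pre st //= /andP[si sc] pcst.
rewrite -iterS iterSr -cat_rcons.
rewrite (_ : step _ _ _ _ = exec w D i st).
  apply: IH => //; rewrite size_rcons -pcst.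
  by case: st {pcst} => p r m; case: i si.
by rewrite /step pcst cat_rcons onth_cat ltnn subnn.
Qed.

Lemma run_code B w D rho v e d st : bounded v e ->
  (forall u, u < v -> rho u < d) ->
  regs (run w D (code B rho e d) st) d = eval B w D (regs st \o rho) e /\
  forall x, x < d -> regs (run w D (code B rho e d) st) x = regs st x.
Proof.
elim: e d st => [u|u|o e1 IH1 e2 IH2|k e IH] d st /= be rd.
- case: st => p r m; rewrite /run /= /update eqxx; split=> [|x xd].
    by rewrite /eval_binop PeanoNat.Nat.lor_diag modn_mod.
  by rewrite ltn_eqF.
- case: st => p r m; rewrite /run /= /update eqxx; split=> // x xd.
  by rewrite ltn_eqF.
- case/andP: be => be1 be2; rewrite !run_cat.
  have [E1 F1] := IH1 d st be1 rd; set st1 := run w D (code B rho e1 d) st in E1 F1 *.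
  have rd1 u : u < v -> rho u < d.+1 by move/rd/leqW.
  have [E2 F2] := IH2 d.+1 st1 be2 rd1.
  set st2 := run w D (code B rho e2 d.+1) st1 in E2 F2 *.
  rewrite (@eval_ext _ _ _ (regs st1 \o rho) (regs st \o rho) v) // in E2; last first.
    by move=> u /rd /F1.
  rewrite -E1 -E2 -(F2 d) //.
  case: (st2) F2 => p r m /= F2; rewrite /run /= /update eqxx; split=> // x xd.
  by rewrite ltn_eqF // F2 ?F1 // leqW.
- rewrite run_cat; have [E1 F1] := IH d st be rd.
  rewrite -E1; case: (run _ _ _ _) F1 => p r m /= F1.
  rewrite /run /= /update eqxx; split=> // x xd.
  by rewrite ltn_eqF // F1.
Qed.

Lemma iter_halted w P D st T : size P <= pc st -> iter T (step w P D) st = st.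
Proof.
by move=> h; elim: T => //= T ->; rewrite /step onth_default.
Qed.

(* Jumps behind the end of the program, which halt it, are clipped to its end. *)
Definition relocate (A p0 sz : nat) (i : instr) : instr :=
  match i with
  | Fetch d k x => Fetch d (A + k) x
  | JumpZ x l => JumpZ x (p0 + minn l sz)
  | _ => i
  end.

Definition reg_bound (i : instr) : nat :=
  match i with
  | Const _ d _ => d.+1
  | Bin _ _ d x y => maxn d.+1 (maxn x.+1 y.+1)
  | Fetch d _ x | Get d x | Put d x => maxn d.+1 x.+1
  | JumpZ x _ => x.+1
  end.

Section Relocation.

Variables (w A M : nat) (P pre post : program) (D D' : memory).
Hypothesis DD' : forall k, nth [::] D' (A + k) = nth [::] D k.
Hypothesis PM : all (fun i => reg_bound i <= M) P.

Let P' := pre ++ map (relocate A (size pre) (size P)) P ++ post.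

(* The registers from [M] on keep the contents [high] during the simulation. *)
Definition simulates (high : nat -> nat) (st st' : state) : Prop :=
  [/\ pc st' = size pre + minn (pc st) (size P),
      forall x, x < M -> regs st' x = regs st x,
      forall x, M <= x -> regs st' x = high x
    & forall x, work st' x = work st x].

Lemma simulates_step high st st' : simulates high st st' -> pc st < size P ->
  simulates high (step w P D st) (step w P' D' st').
Proof.
case: st st' => p r m [p' r' m'] [/= -> low hi mem] pP.
rewrite /step /= (minn_idPl (ltnW pP)).
have -> : onth P p = Some (nth (Const 0 0 0) P p).
  by rewrite onthE (nth_map (Const 0 0 0)).
have -> : onth P' (size pre + p) =
    Some (relocate A (size pre) (size P) (nth (Const 0 0 0) P p)).
  rewrite /P' onth_cat ltnNge leq_addr addKn onth_cat size_map pP.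
  by rewrite /= onth_map onthE (nth_map (Const 0 0 0)).
have := all_nthP (Const 0 0 0) PM p pP.
have upd (f g : nat -> nat) d u u' : d < M -> u = u' ->
    (forall x, x < M -> f x = g x) ->
    (forall x, M <= x -> f x = high x) ->
  (forall x, x < M -> update f d u x = update g d u' x) /\
  (forall x, M <= x -> update f d u x = high x).
  move=> dM <- fg fh; split=> x xM; rewrite /update.
    by case: eqP => // _; apply: fg.
  by rewrite gtn_eqF ?fh // (leq_trans dM xM).
have pcS : size pre + (minn p (size P)).+1 = size pre + minn p.+1 (size P).
  by rewrite (minn_idPl (ltnW pP)) (minn_idPl pP).
rewrite (minn_idPl (ltnW pP)) in pcS.
case: (nth _ P p) => [b d v|b o d x y|d k x|d x|x y|x l] /=; rewrite ?geq_max.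
- move=> dM; have [h1 h2] := upd r' r d (v %% 2 ^ (b * w)) _ dM erefl low hi.
  by split; rewrite //= -addnS.
- case/and3P=> dM xM yM.
  have [h1 h2] := upd r' r d _ _ dM
    (congr2 (eval_binop (b * w) o) (low _ xM) (low _ yM)) low hi.
  by split; rewrite //= -addnS.
- case/andP=> dM xM; rewrite DD'.
  have [h1 h2] := upd r' r d _ _ dM (congr1 (word_of w (nth [::] D k)) (low _ xM)) low hi.
  by split; rewrite //= -addnS.
- case/andP=> dM xM.
  have [h1 h2] := upd r' r d _ _ dM (etrans (mem (r' x)) (congr1 m (low _ xM))) low hi.
  by split; rewrite //= -addnS.
- case/andP=> xM yM; split; rewrite //= -?addnS // => z.
  by rewrite /update low // low // mem.
- move=> xM; split; rewrite //= low //.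
  by case: eqP => _; rewrite -?addnS.
Qed.

(** Where [P] halts, [P'] goes on with [post]. The simulation therefore stops at the first step [T0]
    at which [P] has halted. *)
Lemma simulates_halt high T st st' : simulates high st st' ->
  size P <= pc (iter T (step w P D) st) ->
  exists2 T0, T0 <= T &
    simulates high (iter T (step w P D) st) (iter T0 (step w P' D') st').
Proof.
elim: T st st' => [|T IH] st st' sim halt; first by exists 0.
case: (leqP (size P) (pc st)) => [h|h].
  by exists 0; rewrite ?(@iter_halted w P D st).
rewrite iterSr in halt.
have [T0 T0T sim'] := IH _ _ (simulates_step sim h) halt.
by exists T0.+1; rewrite // !iterSr.
Qed.

Lemma outputs_within_wrap input input' T v v' :
  all straight pre -> all straight post -> 0 < M ->
  outputs_within w P D input' T v ->
  (forall x, x < M ->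
     regs (run w D' pre (init input)) x = nth 0 input' x) ->
  (forall st, regs st 0 = v ->
     (forall x, M <= x -> regs st x = regs (run w D' pre (init input)) x) ->
     regs (run w D' post st) 0 = v') ->
  outputs_within w P' D' input (T + (size pre + size post)) v'.
Proof.
move=> spre spost M0 [halt out] hpre hpost.
set st1 := run w D' pre (init input) in hpre hpost.
have [pc1 work1] := straight_run w D' (init input) spre.
have sim : simulates (regs st1) (init input') st1.
  by split=> //; rewrite /st1 ?pc1 ?work1 //= min0n addn0.
have [T0 T0T [pc2 low2 high2 _]] := simulates_halt sim halt.
set st2 := iter T0 _ _ in pc2 low2 high2.
rewrite (minn_idPr halt) in pc2.
have E2 : iter (size post) (step w P' D') st2 = run w D' post st2.
  rewrite -(@iter_step_run w D' (pre ++ map (relocate A (size pre) (size P)) P)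
    post [::]) // ?cats0 -?catA // size_cat size_map //.
have [pc3 _] := straight_run w D' st2 spost.
rewrite /outputs_within.
(* Read from right to left: [pre], the simulation of [P], [post], and [T - T0] idle steps after
   halting. *)
have -> : T + (size pre + size post) =
    T - T0 + (size post + (T0 + size pre)) by lia.
rewrite !iterD (_ : iter (size pre) _ _ = st1); last first.
  exact: (@iter_step_run w D' [::]).
rewrite -/st2 E2 iter_halted; last first.
  by rewrite pc3 pc2 /P' !size_cat size_map addnA.
split; first by rewrite pc3 pc2 /P' !size_cat size_map addnA.
by apply: hpost => //; rewrite low2.
Qed.

End Relocation.

(** * The grid and the color table *)

Lemma filter_sorted_take (T : eqType) (r : rel T) (p : pred T) (s : seq T) :
  transitive r -> (forall a b, r a b -> p b -> p a) -> sorted r s ->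
  filter p s = take (count p s) s.
Proof.
move=> rtr rp; elim: s => //= x s IH xs; rewrite IH ?(path_sorted xs) //.
case: ifP => //= px; have -> : count p s = 0; last by rewrite take0.
apply/eqP; rewrite -leqn0 leqNgt -has_count; apply/hasPn => y ys.
have /allP /(_ y ys) := order_path_min rtr xs.
by move=> /rp h; apply/negP => /h; rewrite px.
Qed.

(* The numbers [1, ..., n * sigma] fill a grid of [sigma] rows and [n]
   columns, both counted from 0, row by row. *)
Definition row (n y : nat) : nat := y.-1 %/ n.
Definition col (n y : nat) : nat := y.-1 %% n.

(** A column may hold several points or none, so string positions are not columns; column counts
    translate between the two. *)
Definition grid_string (n : nat) (X : seq nat) : seq nat :=
  [seq (row n y).+1 | y <- sort (fun a b => col n a <= col n b) X].

Lemma grid_string_is_string n sigma X : 0 < n ->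
  is_point_set n (n * sigma) X -> is_string n sigma (grid_string n X).
Proof.
move=> n0 [sX _ X1]; split; first by rewrite size_map size_sort.
move=> a /mapP[y]; rewrite mem_sort => /X1 /andP[y1 yn] -> /=.
by rewrite /row ltn_divLR // mulnC; lia.
Qed.

(** The points in columns below [c] form a prefix of the list sorted by column, and the argument of
    [rank] is the length of this prefix. *)
Lemma rank_grid_string n X a c :
  rank a.+1 (grid_string n X) (count (fun y => col n y < c) X) =
  count (fun y => (row n y == a) && (col n y < c)) X.
Proof.
set r := fun a b => col n a <= col n b.
rewrite /rank /grid_string -/r -(count_sort r) -map_take -(filter_sorted_take (r := r)).
- by rewrite count_map count_filter count_sort; apply: eq_count.
- by move=> y x z; apply: leq_trans.
- by move=> u v; apply: leq_ltn_trans.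
- by apply: sort_sorted => u v; apply: leq_total.
Qed.

(** The usual order is the lexicographic order on rows and columns. *)
Lemma count_grid n X x : 0 < n -> 0 < x -> {in X, forall y, 0 < y} ->
  count (fun y => y <= x) X =
  count (fun y => row n y < row n x) X +
  count (fun y => (row n y == row n x) && (col n y < (col n x).+1)) X.
Proof.
move=> n0 x0; elim: X => //= y X IH X0.
rewrite IH => [|z zX]; last by apply: X0; rewrite inE zX orbT.
have y0 : 0 < y by apply: X0; rewrite mem_head.
rewrite addnACA; congr addn; rewrite ltnS /row /col.
have -> : (y <= x) = (y.-1 <= x.-1) by lia.
move: y.-1 x.-1 => p q.
have := divn_eq q n; have := divn_eq p n; have := ltn_pmod p n0.
have := ltn_pmod q n0; set a := p %/ n; set b := q %/ n.
case: (ltngtP a b) => [ab|ab|->] /= h1 h2 h3 h4; [| |lia].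
  have : a.+1 * n <= b * n by rewrite leq_mul2r ab orbT.
  by rewrite mulSn; lia.
have : b.+1 * n <= a * n by rewrite leq_mul2r ab orbT.
by rewrite mulSn; lia.
Qed.

(** For [x <= x'], the elements up to [x] are among those up to [x']; equal counts make the two sets
    equal. *)
Lemma predecessor_color_ext X color x x' :
  count (fun y => y <= x) X = count (fun y => y <= x') X ->
  predecessor_color X color x = predecessor_color X color x'.
Proof.
wlog le : x x' / x <= x' => [hw|cx].
  by case/orP: (leq_total x x') => le cx; [|symmetry]; apply: hw.
have eqX : {in X, (fun y => y <= x) =1 (fun y => y <= x')}.
  elim: X cx => //= z X IH cx y.
  have sub : count (fun y => y <= x) X <= count (fun y => y <= x') X.
    by apply: sub_count => t /= tx; apply: leq_trans tx le.
  have zz : z <= x -> z <= x' by move=> zx; apply: leq_trans zx le.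
  have [zE cE] : (z <= x) = (z <= x') /\
      count (fun y => y <= x) X = count (fun y => y <= x') X.
    by move: zz cx; case: (z <= x) (z <= x') => [] [] /= zz cx; split; lia.
  by rewrite inE => /orP[/eqP -> // | yX]; apply: IH.
rewrite /predecessor_color /has_predecessor (eq_in_has eqX).
rewrite (_ : predecessor X x = predecessor X x') //.
rewrite /predecessor big_seq_cond [RHS]big_seq_cond; apply: eq_bigl => y.
by case yX: (y \in X) => //=; apply: eqX.
Qed.

(* Indexed by the number of elements that are at most the query. *)
Definition color_table (u : nat) (X : seq nat) (color : nat -> bool) : bitseq :=
  pack (size X).+1 (muln^~ 2) 2
    (fun k _ => predecessor_color X color
       (find (fun x => count (fun y => y <= x) X == k) (iota 0 u.+1)))
    ((size X).+1 * 2).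

Lemma num_color_table u X color x : x <= u ->
  num (color_table u X color) (count (fun y => y <= x) X * 2) 2 =
  predecessor_color X color x.
Proof.
move=> xu; set k := count _ X.
have kX : k <= size X by apply: count_size.
rewrite /color_table num_pack_array ?leq_mul2r ?ltnS ?kX //.
set p := fun x => _.
have hp : has p (iota 0 u.+1).
  by apply/hasP; exists x; rewrite ?mem_iota //= /p -/k.
have := nth_find 0 hp; rewrite has_find size_iota in hp.
rewrite nth_iota // add0n => /eqP /predecessor_color_ext ->.
by rewrite modn_small // /predecessor_color; case: ifP => // _; case: (color _).
Qed.

(** * The prefix structure with a logarithmic [lam] *)

Definition prefix_memory (f : nat -> nat) (m n : nat) : memory :=
  let lam := (trunc_log 2 (n + m)).+1 in
  prefix_arrays f m n lam (subblock_size lam).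

Lemma subblock_size_gt0 lam : 0 < subblock_size lam.
Proof. by rewrite /subblock_size addnS. Qed.

Section PrefixMemory.

Variable c0 : nat.
Hypothesis window_le : forall lam, 0 < lam ->
  let mu := subblock_size lam in mu * mu + 3 * mu <= lam + c0.

(** Bounding each factor [mu] by [2 ^ mu] turns the size into [2 ^ (mu * mu + 3 * mu)], whence the
    form of [window_le]. *)
Lemma window_table_le lam mu : 0 < lam -> mu = subblock_size lam ->
  2 ^ (mu * mu + mu) * (mu * mu) <= 2 ^ (lam + c0).
Proof.
move=> lam0 muE.
have mu2 : mu <= 2 ^ mu by apply: ltnW; apply: ltn_expl.
apply: leq_trans (leq_mul (leqnn _) (leq_mul mu2 mu2)) _.
rewrite -!expnD leq_exp2l //; have := window_le lam0; rewrite -muE /=; lia.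
Qed.

(** The choice of [lam] gives [n + m < 2 ^ lam <= 2 * (n + m)], so a table of [2 ^ (lam + c0)] bits
    is linear. *)
Lemma bits_prefix_memory f m n : 0 < n ->
  bits (prefix_memory f m n) <= (8 * 2 ^ c0 + 30) * (n + m).
Proof.
move=> n0; apply: bits_prefix_arrays; rewrite ?subblock_size_gt0 //.
  have /andP[h _] := trunc_log_bounds (isT : 1 < 2) (ltn_addr m n0).
  by rewrite expnS leq_mul2l h.
by rewrite -expnD [c0 + _]addnC; apply: window_table_le.
Qed.

Lemma eval_prefix_memory E w D reg W f m n o e j :
  0 < w -> eval (4 * (E + 1 + c0) + 4) w D reg W = w ->
  {homo f : i j / i <= j} -> (forall j, f j <= n) -> 0 < n ->
  n + m <= 2 ^ (E * w) ->
  (forall i, i < 9 -> nth [::] D (o + i) = nth [::] (prefix_memory f m n) i) ->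
  eval (4 * (E + 1 + c0) + 4) w D reg e = j -> j <= m ->
  eval (4 * (E + 1 + c0) + 4) w D reg (prefix_expr W (E + 1 + c0) o e) = f j.
Proof.
move=> w0 eW fle fn n0 nmE st ee jm.
set lam := (trunc_log 2 (n + m)).+1; set mu := subblock_size lam.
have nm0 : 0 < n + m by apply: ltn_addr.
have /andP[nm1 nm2] := trunc_log_bounds (isT : 1 < 2) nm0.
have lamE : lam <= (E + 1) * w.
  have : 2 ^ trunc_log 2 (n + m) <= 2 ^ (E * w) by apply: leq_trans nm1 _.
  by rewrite leq_exp2l // mulnDl mul1n /lam; lia.
(* The [c0] extra words absorb the additive constant of [window_le]. *)
have lamR : lam + c0 <= (E + 1 + c0) * w.
  by rewrite mulnDl; apply: leq_add => //; apply: leq_pmulr.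
have win := window_le (isT : 0 < lam); rewrite -/mu /= in win.
apply: (@eval_prefix _ w D reg W _ w0 eW f m n lam mu o) => //.
- by rewrite addn1.
- exact: subblock_size_gt0.
- by apply: leq_ltn_trans nm2; apply: leq_addr.
- by apply: leq_trans nm2; rewrite /lam; lia.
- exact: block_size_le.
- by apply: leq_trans lamR; apply: leq_addr.
- by apply: leq_trans lamR; lia.
- by apply: leq_trans (window_table_le _ erefl) _ => //; rewrite leq_exp2l.
Qed.

End PrefixMemory.

(** * Sequences of assignments *)

Fixpoint assign (B : nat) (rho : nat -> nat) (es : seq expr) (v : nat) : program :=
  if es is e :: es' then code B rho e (rho v) ++ assign B rho es' v.+1 else [::].

Lemma straight_assign B rho es v : all straight (assign B rho es v).
Proof. by elim: es v => //= e es IH v; rewrite all_cat straight_code IH. Qed.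

Lemma size_assign B rho es v :
  size (assign B rho es v) = sumn (map expr_size es).
Proof. by elim: es v => //= e es IH v; rewrite size_cat size_code IH. Qed.

(** The right-hand sides may be evaluated in the final state: each mentions earlier variables only,
    and the code for a target writes to no register below that target. *)
Lemma run_assign B w D rho es v st :
  {mono rho : x y / x < y} ->
  (forall i, i < size es -> bounded (v + i) (nth (Cst 0) es i)) ->
  let st' := run w D (assign B rho es v) st in
  (forall x, x < rho v -> regs st' x = regs st x) /\
  (forall i, i < size es ->
    regs st' (rho (v + i)) = eval B w D (regs st' \o rho) (nth (Cst 0) es i)).
Proof.
move=> rlt; elim: es v st => [|e es IH] v st //= bnd.
rewrite run_cat; set st1 := run _ _ (code _ _ _ _) st.
have b0 : bounded v e by have := bnd 0 isT; rewrite addn0.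
have [E1 F1] : regs st1 (rho v) = eval B w D (regs st \o rho) e /\
    forall x, x < rho v -> regs st1 x = regs st x.
  by apply: run_code b0 _ => u; rewrite rlt.
have [|F2 E2] := IH v.+1 st1; first by move=> i ie; rewrite addSnnS; apply: bnd.
set st2 := run _ _ _ st1 in F2 E2 *.
have rS x : x < rho v -> x < rho v.+1.
  by move=> h; apply: ltn_trans h _; rewrite rlt.
split=> [x xv|[|i] ie]; first by rewrite F2 ?F1 // rS.
  rewrite addn0 F2 ?rlt // E1; apply: eval_ext b0 _ => u uv /=.
  have ru : rho u < rho v by rewrite rlt.
  by rewrite F2 ?F1 // rS.
by rewrite -addSnnS E2.
Qed.

Lemma bounded_words v W T k j :
  bounded v W -> bounded v j -> bounded v (words W T k j).
Proof. by move=> bW; elim: T j => //= T IH j bj; rewrite bj bW IH //= bj. Qed.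

Lemma bounded_read v W R k p len : bounded v W -> bounded v p ->
  bounded v len -> bounded v (read W R k p len).
Proof.
move=> bW bp bl; rewrite /read.
by move: (words _ _ _ _) (bounded_words R.+1 k bW (j := p /^ W)) => ws /= ->;
  rewrite /= ?bp ?bW ?bl.
Qed.

Lemma bounded_prefix v W R o j :
  bounded v W -> bounded v j -> bounded v (prefix_expr W R o j).
Proof.
move=> bW bj; rewrite /prefix_expr.
by repeat first [ done | apply: bounded_read | apply: bounded_words
                | apply/andP; split ].
Qed.

(** * The query program *)

Definition row_expr : expr := (Var 3 -^ Cst 1) /^ Var 0.
Definition col_expr : expr := (Var 3 -^ Cst 1) %^ Var 0.

(* Variables 0, 1, 2, 3 are n, sigma, w, x. Variables 5 to 9 hold, in this
   order, w, the number of elements in the rows above x, the number i of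
   elements in the columns up to x, and both arguments of the rank query. The
   latter is issued at max(i, 1), as rank is only available for positive
   positions; [color_expr] discards its answer if i = 0. *)
Definition query_exprs (R : nat) : seq expr :=
  [:: Var 2; prefix_expr (Var 2) R 0 row_expr;
      prefix_expr (Var 2) R 9 (col_expr +^ Cst 1);
      row_expr +^ Cst 1; Var 7 +^ Op OpEq (Var 7) (Cst 0)].

(** This runs after the rank program, which may have overwritten its inputs: [Var 0] is now its
    answer and [Var 5] the saved word size. Array 18 is the color table. *)
Definition color_expr (R : nat) : expr :=
  read (Var 5) R 18 ((Var 6 +^ Var 0 *^ (Cst 0 <^ Var 7)) *^ Cst 2) (Cst 2).

(* The first [M] registers are those of the rank program. *)
Definition var_reg (M v : nat) : nat := if v < 5 then v else M + (v - 5).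

(** The copies into registers 3 and 4 come last, since the first one overwrites [x]. *)
Definition query_prefix (B R M : nat) : program :=
  let rho := var_reg M in
  assign B rho (query_exprs R) 5 ++
  [:: Bin B OpOr 3 (rho 8) (rho 8); Bin B OpOr 4 (rho 9) (rho 9)].

Definition query_suffix (B R M : nat) : program :=
  let rho := var_reg M in
  code B rho (color_expr R) (rho 10) ++ [:: Bin B OpOr 0 (rho 10) (rho 10)].

Definition program_bound (P : program) : nat :=
  maxn 5 (foldr maxn 0 (map reg_bound P)).

Lemma program_boundP P : all (fun i => reg_bound i <= program_bound P) P.
Proof.
rewrite /program_bound.
apply: (@sub_all _ (fun i => reg_bound i <= foldr maxn 0 (map reg_bound P))).
  by move=> i h; apply: leq_trans h (leq_maxr _ _).
elim: P => //= i P IH; rewrite leq_maxl /=.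
by apply: sub_all IH => j h; apply: leq_trans h (leq_maxr _ _).
Qed.

Lemma var_reg_mono M : 5 <= M -> {mono var_reg M : x y / x < y}.
Proof. by move=> M5 x y; rewrite /var_reg; case: (ltnP x 5); case: (ltnP y 5); lia. Qed.

Lemma outputs_within_le w P D input T T' v : T <= T' ->
  outputs_within w P D input T v -> outputs_within w P D input T' v.
Proof.
move=> TT' [halt out]; rewrite /outputs_within -(subnK TT') iterD.
by rewrite iter_halted.
Qed.

Lemma bounded_query_exprs R i : i < 5 -> bounded (5 + i) (nth (Cst 0) (query_exprs R) i).
Proof. by case: i => [|[|[|[|[|i]]]]] // _; apply: bounded_prefix. Qed.

Section Query.

Variables (c0 n sigma : nat).
Hypothesis window_le : forall lam, 0 < lam ->
  let mu := subblock_size lam in mu * mu + 3 * mu <= lam + c0.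
Hypothesis n0 : 0 < n.

Variables (X : seq nat) (color : nat -> bool) (D : memory).
Hypothesis pX : is_point_set n (n * sigma) X.

Definition row_count (j : nat) : nat := count (fun y => row n y < j) X.
Definition col_count (j : nat) : nat := count (fun y => col n y < j) X.

(** The two prefix structures have nine arrays each; with the color table, the arrays of the rank
    structure are shifted by 19. *)
Definition query_memory : memory :=
  prefix_memory row_count sigma n ++ prefix_memory col_count n n ++
  color_table (n * sigma) X color :: D.

Lemma bits_query_memory :
  bits query_memory <= bits D + (24 * 2 ^ c0 + 100) * (n + sigma).
Proof.
have -> : bits query_memory = bits (prefix_memory row_count sigma n) +
    (bits (prefix_memory col_count n n) +
      (size (color_table (n * sigma) X color) + bits D)).
  by rewrite /bits big_cat big_cat big_cons.
have [sX _ _] := pX; rewrite size_pack sX.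
have := bits_prefix_memory window_le row_count sigma n0.
have := bits_prefix_memory window_le col_count n n0.
rewrite !mulnDl !mulnDr; lia.
Qed.

Variables (C K w x M : nat).
Hypotheses (s0 : 0 < sigma) (w0 : 0 < w).
Hypotheses (nC : n <= 2 ^ (C * w)) (sK : sigma <= 2 ^ (K * w)).
(** [C + K] words hold [n * sigma]; one more makes room for [n + sigma] and [n + n]. *)
Let E := C + K + 1.
Let R := E + 1 + c0.
Let B := 4 * R + 4.
Hypotheses (x1 : 1 <= x <= n * sigma) (M5 : 5 <= M).

Let input := [:: n; sigma; w; x].
Let st1 := run w query_memory (query_prefix B R M) (init input).
Let i := col_count (col n x).+1.

Let small : n + n + R + 10 < 2 ^ (B * w) /\ n * sigma < 2 ^ (B * w).
Proof.
have n2 : 2 ^ (C * w) <= 2 ^ (R * w).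
  by rewrite leq_exp2l // leq_mul2r /R /E; apply/orP; right; lia.
have RZ : R < 2 ^ (R * w).
  by apply: leq_ltn_trans (ltn_expl _ _); rewrite // leq_pmulr.
have Z4 : 4 <= 2 ^ (R * w).
  apply: (@leq_trans (2 ^ 2)) => //.
  by rewrite leq_exp2l // (@leq_trans R) ?leq_pmulr // /R /E; lia.
have ZB : 2 ^ (R * w) * 16 <= 2 ^ (B * w).
  rewrite -(expnD 2 _ 4) leq_exp2l // /B mulnDl -mulnA; nia.
split; first by lia.
have h : n * sigma <= 2 ^ (R * w).
  apply: leq_trans (leq_mul nC sK) _; rewrite -expnD leq_exp2l // -mulnDl.
  by rewrite leq_mul2r /R /E; apply/orP; right; lia.
lia.
Qed.

Let small' y : y <= n + n + R + 9 -> y < 2 ^ (B * w).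
Proof. by have [h _] := small; lia. Qed.

Let B0 : 0 < B. Proof. by rewrite /B addnS. Qed.

Let col_le j : col_count j <= n.
Proof. by have [<- _ _] := pX; apply: count_size. Qed.

Let row_le j : row_count j <= n.
Proof. by have [<- _ _] := pX; apply: count_size. Qed.

Lemma run_query_prefix :
  (forall u, u < M ->
     regs st1 u = nth 0 [:: n; sigma; w; (row n x).+1; maxn i 1] u) /\
  [/\ regs st1 (var_reg M 5) = w,
      regs st1 (var_reg M 6) = row_count (row n x)
    & regs st1 (var_reg M 7) = i].
Proof.
rewrite /st1 /query_prefix run_cat.
have [F V] := @run_assign B w query_memory (var_reg M) (query_exprs R) 5
  (init input) (var_reg_mono M5) (@bounded_query_exprs R).
move: (run _ _ (assign _ _ _ _) _) F V => st F V.
have r0 u : u < 5 -> var_reg M u = u by rewrite /var_reg => ->.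
have F5 u : u < M -> regs st u = nth 0 input u.
  by move=> uM; rewrite F // /var_reg /= addn0.
set ev := eval B w query_memory (regs st \o var_reg M) in V.
have Fv u : u < 5 -> (regs st \o var_reg M) u = nth 0 input u.
  by move=> u5; rewrite /= r0 // F5 // (leq_trans u5).
have [_ xQ] := small; have /andP[x0 xn] := x1.
have wQ : w < 2 ^ (B * w).
  by apply: leq_ltn_trans (ltn_expl _ (isT : 1 < 2)); apply: leq_pmull.
have Vn : ev (Var 0) = n by rewrite /ev eval_var Fv //= small'; lia.
have Vw : ev (Var 2) = w by rewrite /ev eval_var Fv.
have Vx : ev (Var 3) = x.
  by rewrite /ev eval_var Fv //=; apply: leq_ltn_trans xn xQ.
have C1 : ev (Cst 1) = 1 by rewrite /ev eval_cst // small'; lia.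
have C0 : ev (Cst 0) = 0 by rewrite /ev eval_cst // small'; lia.
have Vx1 : ev (Var 3 -^ Cst 1) = x.-1.
  by rewrite /ev eval_sub -/ev ?Vx ?C1 ?subn1.
have Vrow : ev row_expr = row n x by rewrite /ev eval_div -/ev ?Vx1 ?Vn.
have Vcol : ev col_expr = col n x by rewrite /ev eval_mod -/ev ?Vx1 ?Vn.
have coln : col n x < n by rewrite ltn_pmod.
have rows : row n x < sigma by rewrite ltn_divLR // mulnC; lia.
have Vcol1 : ev (col_expr +^ Cst 1) = (col n x).+1.
  by rewrite /ev eval_add -/ev ?Vcol ?C1 ?addn1 ?small' //; lia.
have ns : n * sigma < 2 ^ (B * w) by [].
have sQ : sigma <= n * sigma by apply: leq_pmull.
have Vrow1 : ev (row_expr +^ Cst 1) = (row n x).+1.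
  rewrite /ev eval_add -/ev ?Vrow ?C1 ?addn1 //.
  by apply: leq_ltn_trans ns; apply: leq_trans sQ.
have W : regs st (var_reg M 5) = w by rewrite -Vw; apply: (V 0).
have V6 := V 1 isT; have V7 := V 2 isT.
have V8 : regs st (var_reg M 8) = (row n x).+1 by rewrite -Vrow1; apply: (V 3).
have V9 : regs st (var_reg M 9) = ev (Var 7 +^ Op OpEq (Var 7) (Cst 0)).
  by apply: (V 4).
have nsE : n + sigma <= 2 ^ (E * w).
  have : 2 ^ (C * w) + 2 ^ (K * w) <= 2 ^ (E * w); last by lia.
  have := leq_pexp2l (isT : 0 < 2) (leq_addr (K * w) (C * w)).
  have := leq_pexp2l (isT : 0 < 2) (leq_addl (C * w) (K * w)).
  have : 2 ^ (C * w + K * w).+1 <= 2 ^ (E * w).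
    by rewrite leq_exp2l // /E !mulnDl mul1n; lia.
  by rewrite expnS; lia.
have nnE : n + n <= 2 ^ (E * w).
  have : 2 * 2 ^ (C * w) <= 2 ^ (E * w); last by lia.
  by rewrite -expnS leq_exp2l // /E !mulnDl mul1n; lia.
have homoc (p : nat -> nat) : {homo (fun j => count (fun y => p y < j) X) : a b / a <= b}.
  by move=> a b ab; apply: sub_count => y /= h; apply: leq_trans h ab.
have {}V6 : regs st (var_reg M 6) = row_count (row n x).
  rewrite V6 /ev.
  apply: (eval_prefix_memory window_le (m := sigma) (n := n)) => //.
  - exact: homoc.
  - by do 9! [case => [//|]].
  - exact: ltnW.
have {}V7 : regs st (var_reg M 7) = i.
  rewrite V7 /ev.
  apply: (eval_prefix_memory window_le (m := n) (n := n)) => //.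
  - exact: homoc.
  - by do 9! [case => [//|]].
have Vi : ev (Var 7) = i.
  rewrite /ev eval_var /= V7 // small' //.
  by have := col_le (col n x).+1; rewrite -/i; lia.
have {}V9 : regs st (var_reg M 9) = maxn i 1.
  have Eq : ev (Op OpEq (Var 7) (Cst 0)) = (i == 0).
    by rewrite /ev eval_eq // -/ev Vi C0.
  rewrite V9 /ev eval_add -/ev // Vi Eq.
    by case: (i) => [|j] //=; rewrite addn0 (maxn_idPl _).
  by rewrite small' //; have := col_le (col n x).+1; rewrite -/i; case: eqP; lia.
have lor y : y < 2 ^ (B * w) -> eval_binop (B * w) OpOr y y = y.
  by move=> yQ; rewrite /eval_binop PeanoNat.Nat.lor_diag modn_mod modn_small.
have high u v : u < 5 -> 5 <= v -> (var_reg M v == u) = false.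
  by move=> u5 v5; rewrite /var_reg ltnNge v5 /=; apply/eqP; lia.
clear F V Fv ev Vn Vw Vx C1 C0 Vx1 Vrow Vcol Vcol1 Vrow1 Vi.
case: st F5 W V6 V7 V8 V9 => p r m /= F5 W V6 V7 V8 V9.
rewrite /update !high //; split=> [u uM|//].
have r8 : r (var_reg M 8) < 2 ^ (B * w).
  by rewrite V8; apply: leq_ltn_trans ns; apply: leq_trans sQ.
have r9 : r (var_reg M 9) < 2 ^ (B * w).
  by rewrite V9 small' //; have := col_le (col n x).+1; rewrite -/i; lia.
rewrite !lor // V8 V9.
by case: u uM => [|[|[|[|[|u]]]]] //= uM; rewrite F5 //= nth_nil.
Qed.

Lemma run_query_suffix st :
  regs st 0 = rank (row n x).+1 (grid_string n X) (maxn i 1) ->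
  (forall u, M <= u -> regs st u = regs st1 u) ->
  regs (run w query_memory (query_suffix B R M) st) 0 =
  predecessor_color X color x.
Proof.
move=> st0 high; have [_ [W V6 V7]] := run_query_prefix.
have rM v : 5 <= v -> regs st (var_reg M v) = regs st1 (var_reg M v).
  by move=> v5; rewrite high // /var_reg ltnNge v5 leq_addr.
rewrite -!rM // in W V6 V7.
rewrite /query_suffix run_cat.
have bc : bounded 10 (color_expr R) by apply: bounded_read.
have rho_lt u : u < 10 -> var_reg M u < var_reg M 10 by rewrite var_reg_mono.
have [Ecolor _] := run_code B w query_memory st bc rho_lt.
have [_ xQ] := small; have /andP[x0 xn] := x1.
have [sX _ X1] := pX.
set ev := eval B w query_memory (regs st \o var_reg M) in Ecolor.
have rank_le a S j : rank a S j <= size S.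
  by rewrite /rank (leq_trans (count_size _ _)) // size_take; case: ltnP => // /ltnW.
have v0 : var_reg M 0 = 0 by [].
have sS : size (grid_string n X) = n by rewrite size_map size_sort.
have Vr : ev (Var 0) = rank (row n x).+1 (grid_string n X) (maxn i 1).
  rewrite /ev eval_var /= v0 st0 // small' //.
  by have := rank_le (row n x).+1 (grid_string n X) (maxn i 1); rewrite sS; lia.
have wQ : w < 2 ^ (B * w).
  by apply: leq_ltn_trans (ltn_expl _ (isT : 1 < 2)); apply: leq_pmull.
have Vw : ev (Var 5) = w by rewrite /ev eval_var /= W.
have V6' : ev (Var 6) = row_count (row n x).
  by rewrite /ev eval_var /= V6 // small' //; have := row_le (row n x); lia.
have Vi : ev (Var 7) = i.
  rewrite /ev eval_var /= V7 // small' //.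
  by have := col_le (col n x).+1; rewrite -/i; lia.
have C0 : ev (Cst 0) = 0 by rewrite /ev eval_cst // small'; lia.
have C2 : ev (Cst 2) = 2 by rewrite /ev eval_cst // small'; lia.
have Lt : ev (Cst 0 <^ Var 7) = (0 < i) by rewrite /ev eval_ltn // -/ev Vi C0.
set k := count (fun y => (row n y == row n x) && (col n y < (col n x).+1)) X.
(* For [i = 0] the rank at position 1 may be positive, but the factor [0 < i] cancels it, and no
   point lies in the columns concerned. *)
have rk : rank (row n x).+1 (grid_string n X) (maxn i 1) * (0 < i) = k.
  case: posnP => [i0|ip]; last first.
    by rewrite (maxn_idPl ip) muln1 rank_grid_string.
  rewrite muln0; apply/esym/eqP; rewrite -leqn0 -i0.
  by apply: sub_count => y /andP[].
have Vm : ev (Var 0 *^ (Cst 0 <^ Var 7)) = k.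
  rewrite /ev eval_mul // -/ev Vr Lt rk // small' //.
  by rewrite (leq_trans (count_size _ _)) // sX; lia.
have cg := esym (count_grid n0 x0 (fun y yX => proj1 (andP (X1 y yX)))).
rewrite -/(row_count _) -/k in cg.
have cX : count (fun y => y <= x) X <= n by rewrite -sX count_size.
have Vs : ev (Var 6 +^ Var 0 *^ (Cst 0 <^ Var 7)) = count (fun y => y <= x) X.
  by rewrite /ev eval_add // -/ev V6' Vm cg // small' //; lia.
have Vp : ev ((Var 6 +^ Var 0 *^ (Cst 0 <^ Var 7)) *^ Cst 2) =
    count (fun y => y <= x) X * 2.
  by rewrite /ev eval_mul // -/ev Vs C2 // small' //; lia.
have Ecol : ev (color_expr R) = predecessor_color X color x.
  rewrite /color_expr /ev eval_read // -/ev ?Vp ?C2.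
  - exact: num_color_table xn.
  - by rewrite (@leq_trans R) ?leq_pmulr // /R /E; lia.
  - by rewrite ltn_mul2r w0 /B; lia.
  - by have [h _] := small; lia.
rewrite -/ev Ecol in Ecolor.
case: (run _ _ (code _ _ _ _) _) Ecolor => p r m /= ->.
rewrite /update /= /eval_binop PeanoNat.Nat.lor_diag modn_mod modn_small // small' //.
by rewrite /predecessor_color; case: ifP => //; case: (color _); lia.
Qed.

End Query.

Theorem theorem2p1 (w : nat -> nat) (K : nat)
    (w_gt0 : forall n : nat, 0 < w n)
    (w_Omega : bigOmega w lg)
    (lgw_O : bigO (fun n => lg (w n)) lg) :
  exists c : nat, forall s t : nat -> nat -> nat,
    rank_solvable w K s t ->
    colored_predecessor_solvable w K
      (fun n sigma => s n sigma + c * (n + sigma))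
      (fun n sigma => t n sigma + c).
Proof.
have [c0 window_le] := window_size_le.
have [c [n1 lgw]] := w_Omega.
(* For [n >= n1] the bound [lg n <= c * w n] applies; for smaller [n],
   [lg n <= n < n1 <= n1 * w n]. *)
set C := c + n1.
have lgC n : n <= 2 ^ (C * w n).
  apply: leq_trans (up_logP n (isT : 1 < 2)) _; rewrite leq_exp2l //.
  case: (leqP n1 n) => [/lgw h|h].
    by apply: leq_trans h _; rewrite leq_mul2r leq_addr orbT.
  have nn : up_log 2 n <= n by apply: up_log_min => //; apply/ltnW/ltn_expl.
  apply: (leq_trans nn); apply: leq_trans (ltnW h) _.
  by rewrite (@leq_trans C) ?leq_pmulr ?leq_addl.
set R := C + K + 1 + 1 + c0; set B := 4 * R + 4.
(* The length of the added code depends on [R] but not on the rank program, so the constant can be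
   fixed before [s] and [t]. *)
pose size_pre := sumn (map expr_size (query_exprs R)) + 2.
pose size_post := expr_size (color_expr R) + 1.
exists (24 * 2 ^ c0 + 100 + (size_pre + size_post)) => s t [P HP].
set M := program_bound P; have M5 : 5 <= M by apply: leq_maxl.
exists (query_prefix B R M ++
  map (relocate 19 (size (query_prefix B R M)) (size P)) P ++
  query_suffix B R M) => n sigma adm X color pX.
have [n0 s0 sK] := adm.
have {}sK : sigma <= 2 ^ (K * w n).
  by apply: leq_trans (up_logP sigma (isT : 1 < 2)) _; rewrite leq_exp2l.
have [D [bD HD]] := HP n sigma adm _ (grid_string_is_string n0 pX).
exists (query_memory n sigma X color D); split.
  apply: leq_trans (bits_query_memory window_le n0 color D pX) _.
  by apply: leq_add => //; rewrite leq_mul2r leq_addr orbT.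
move=> x x1; set i := col_count n X (col n x).+1.
have iX : i <= n by have [<- _ _] := pX; apply: count_size.
have rows : (row n x).+1 <= sigma by rewrite ltn_divLR // mulnC; lia.
have HR := HD (row n x).+1 (maxn i 1).
have spre : size (query_prefix B R M) = size_pre by rewrite size_cat size_assign.
have spost : size (query_suffix B R M) = size_post by rewrite size_cat size_code.
apply: (@outputs_within_le _ _ _ _
    (t n sigma + (size (query_prefix B R M) + size (query_suffix B R M)))).
  by rewrite spre spost leq_add2l leq_addl.
have [low _] := run_query_prefix window_le n0 color D pX s0 (w_gt0 n) (lgC n) sK x1 M5.
apply: (@outputs_within_wrap _ 19 M _ _ _ D _ _ _ _
    [:: n; sigma; w n; (row n x).+1; maxn i 1] _
    (rank (row n x).+1 (grid_string n X) (maxn i 1))) => //.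
- exact: program_boundP.
- by rewrite all_cat straight_assign.
- by rewrite all_cat straight_code.
- exact: leq_trans M5.
- by apply: HR; rewrite ?leq_maxr ?geq_max ?iX.
- move=> st st0 high.
  exact: (run_query_suffix window_le n0 pX s0 (w_gt0 n) (lgC n) sK x1 M5 st0 high).
Qed.
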